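(* There is an absolute constant $c_0>0$ such that the following holds. For positive integers $n,t$ with $n^2\le t<n^{2.81}$, call $X\in\mathbb{F}_2^{t\times n^2}$ bad if there exist an integer $r$ with $n^2\le r<t$ and a factorization $X=X_1X_2$ with $X_1\in\mathbb{F}_2^{t\times r}$, $X_2\in\mathbb{F}_2^{r\times n^2}$ and $\frac{T(X_1)}{t-r}<c_0\frac{n^2}{\log n}$. Then, for all sufficiently large $n$ (and all such $t$), most matrices $X\in\mathbb{F}_2^{t\times n^2}$ are not bad; that is, the minimum of $\frac{T(X_1)}{t-r}$ over all such $r$ and factorizations is $\Omega(n^2/\log n)$ for most $X$.
   Context: For a matrix $X\in\mathbb{F}_2^{a\times b}$, $T(X)$ denotes the minimum number of arithmetic operations of a linear algorithm (linear circuit over $\mathbb{F}_2$) computing $v\mapsto Xv$. ''Most'' means that the fraction of bad matrices among all $2^{tn^2}$ matrices tends to $0$ as $n\to\infty$. *)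

(* Defs.v *)
From HB Require Import structures.
From mathcomp Require Import all_boot all_order all_algebra.
From mathcomp Require Import all_classical all_reals all_analysis.

Set Implicit Arguments.
Unset Strict Implicit.
Unset Printing Implicit Defensive.

Import Order.TTheory GRing.Theory Num.Theory.

Local Open Scope ring_scope.

(* Linear straight-line programs.  The memory is the list of all values
   available so far: first the [b] coordinates of the input vector, then the
   results of the operations executed so far, in order.  Operands and outputs
   are positions in the memory; a position beyond its end reads the constant 0,
   so that 0 is available at no cost. *)
Inductive lin_op (F : fieldType) : Type :=
| OpAdd of nat & nat
| OpSub of nat & nat
| OpScale of F & nat.

Definition op_value (F : fieldType) (mem : seq F) (o : lin_op F) : F :=
  match o with
  | OpAdd i j => mem`_i + mem`_j
  | OpSub i j => mem`_i - mem`_j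
  | OpScale c i => c * mem`_i
  end.

Definition lin_step (F : fieldType) (mem : seq F) (o : lin_op F) : seq F :=
  rcons mem (op_value mem o).

Definition lin_run (F : fieldType) (b : nat) (p : seq (lin_op F))
    (v : 'cV[F]_b) : seq F :=
  foldl (@lin_step F) [seq v j 0 | j <- enum 'I_b] p.

Definition lin_computes (F : fieldType) (a b : nat) (p : seq (lin_op F))
    (out : 'I_a -> nat) (X : 'M[F]_(a, b)) : Prop :=
  forall (v : 'cV[F]_b) (i : 'I_a), (lin_run p v)`_(out i) = (X *m v) i 0.

Definition lin_computable_in (F : fieldType) (a b : nat) (X : 'M[F]_(a, b))
    (s : nat) : Prop :=
  exists (p : seq (lin_op F)) (out : 'I_a -> nat),
    size p = s /\ lin_computes p out X.

Lemma size_lin_run (F : fieldType) (b : nat) (p : seq (lin_op F))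
    (v : 'cV[F]_b) : size (lin_run p v) = (b + size p)%N.
Proof.
elim/last_ind: p => [|p o IH]; first by rewrite /= size_map size_enum_ord addn0.
by rewrite /lin_run -cats1 foldl_cat /= size_rcons -/(lin_run p v) IH size_cat
  addn1 addnS.
Qed.

Lemma lin_run_rcons (F : fieldType) (b : nat) (p : seq (lin_op F)) o
    (v : 'cV[F]_b) :
  lin_run (rcons p o) v = rcons (lin_run p v) (op_value (lin_run p v) o).
Proof. by rewrite /lin_run -cats1 foldl_cat. Qed.

Lemma nth_lin_run_cat (F : fieldType) (b : nat) (p q : seq (lin_op F))
    (v : 'cV[F]_b) k : (k < b + size p)%N ->
  (lin_run (p ++ q) v)`_k = (lin_run p v)`_k.
Proof.
move=> kp; elim/last_ind: q => [|q o IH]; first by rewrite cats0.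
rewrite -rcons_cat lin_run_rcons nth_rcons size_lin_run size_cat IH.
by rewrite (leq_trans kp) // leq_add2l leq_addr.
Qed.

Lemma nth_lin_run_rcons (F : fieldType) (b : nat) (p : seq (lin_op F)) o
    (v : 'cV[F]_b) :
  (lin_run (rcons p o) v)`_(b + size p) = op_value (lin_run p v) o.
Proof. by rewrite lin_run_rcons nth_rcons size_lin_run ltnn eqxx. Qed.

Lemma lin_run_row (F : fieldType) (b : nat) (w : 'I_b -> F)
    (p : seq (lin_op F)) (s : seq 'I_b) :
  exists (q : seq (lin_op F)) (k : nat), (k < b + size (p ++ q))%N /\
    forall v : 'cV[F]_b,
      (lin_run (p ++ q) v)`_k = \sum_(j <- s) w j * v j 0.
Proof.
elim: s => [|j s [q [k [kq Hq]]]].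
  exists [:: OpSub F 0 0], (b + size p)%N; split.
    by rewrite cats1 size_rcons addnS.
  by move=> v; rewrite cats1 nth_lin_run_rcons /= subrr big_nil.
set p1 := p ++ q in kq Hq.
set p2 := rcons p1 (OpScale (w j) j).
have sp2 : size p2 = (size p1).+1 by rewrite size_rcons.
exists (q ++ [:: OpScale (w j) j; OpAdd F (b + size p1) k]), (b + size p2)%N.
have -> : p ++ q ++ [:: OpScale (w j) j; OpAdd F (b + size p1) k] =
    rcons p2 (OpAdd F (b + size p1) k).
  by rewrite catA /p2 -!cats1 -!catA.
split=> [|v]; first by rewrite size_rcons addnS.
rewrite nth_lin_run_rcons /= /p2 nth_lin_run_rcons -cats1 nth_lin_run_cat //.
rewrite Hq big_cons /=; congr (_ * _ + _).
rewrite -(cat0s p1) nth_lin_run_cat ?addn0 //.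
by rewrite /lin_run /= (nth_map j) ?size_enum_ord // nth_ord_enum.
Qed.

Lemma lin_computable (F : fieldType) (a b : nat) (X : 'M[F]_(a, b)) :
  exists s, lin_computable_in X s.
Proof.
suff [p [out H]] : exists (p : seq (lin_op F)) (out : 'I_a -> nat),
    forall i : 'I_a, i \in enum 'I_a -> (out i < b + size p)%N /\
    forall v : 'cV[F]_b, (lin_run p v)`_(out i) = (X *m v) i 0.
  exists (size p), p, out; split=> // v i.
  by have [] := H i (mem_enum _ _).
elim: (enum 'I_a) => [|i s [p [out H]]]; first by exists [::], (fun=> 0%N).
have [q [k [kq Hq]]] := lin_run_row (X i) p (index_enum 'I_b).
exists (p ++ q), (fun j => if j == i then k else out j) => j.
rewrite inE; have [->|_ /= /H[oj Hj]] := eqVneq j i.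
  by split=> // v; rewrite Hq mxE.
split; first by rewrite (leq_trans oj) // leq_add2l size_cat leq_addr.
by move=> v; rewrite nth_lin_run_cat.
Qed.

Lemma lin_computableb (F : fieldType) (a b : nat) (X : 'M[F]_(a, b)) :
  exists s, `[< lin_computable_in X s >].
Proof. by have [s Xs] := lin_computable X; exists s; apply/asboolP. Qed.

Definition lin_cost (F : fieldType) (a b : nat) (X : 'M[F]_(a, b)) : nat :=
  ex_minn (lin_computableb X).

(* [ln] fixes the base of the logarithm; another base only rescales [c0]. *)
Definition bad (R : realType) (c0 : R) (n t : nat) (X : 'M['F_2]_(t, n ^ 2)) :
    Prop :=
  exists (r : nat) (X1 : 'M['F_2]_(t, r)) (X2 : 'M['F_2]_(r, n ^ 2)),
    [/\ (n ^ 2 <= r)%N, (r < t)%N, X = X1 *m X2 &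
        (lin_cost X1)%:R / (t - r)%:R < c0 * ((n ^ 2)%:R / ln (n%:R : R))].

Definition bad_fraction (R : realType) (c0 : R) (n t : nat) : R :=
  #|[pred X : 'M['F_2]_(t, n ^ 2) | `[< bad c0 X >]]|%:R / (2 ^ (t * n ^ 2))%:R.

(* Main.v *)
(** If [X = X1 *m X2] with [X1] of width [r], the columns of [X] lie in the
    column space [V] of [X1], so a fixed [V] accounts for at most
    [2 ^ (r * n ^ 2)] matrices, and it remains to count the possible [V].
    Counting programs with their outputs is too crude: choosing [t] output
    positions costs [t * log n] bits, more than the [n ^ 2] bits saved when
    [t - r = 1].  Up to permuting the columns of [X1], which preserves [V], this
    choice is almost free: for all but a negligible set of [X] the rows are
    distinct, hence so are the output positions of a program of size [s]
    computing [X1], and all but [s + 1] of the outputs are inputs.  Naming each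
    such input after the output that reads it, [V] is the projection of the
    solution set of [2 * (s + 1)] equations [a = b + c] between polynomially
    many names.  So there are [n ^ O(s + 1)] spaces [V], which is negligible
    against [2 ^ ((t - r) * n ^ 2)] when [s] is a small multiple of
    [(t - r) * n ^ 2 / ln n]. *)

Require Import Defs.
From mathcomp Require Import all_boot all_order all_algebra.
From mathcomp Require Import all_classical all_reals all_analysis.
From mathcomp Require Import zify lra.

Import Order.TTheory GRing.Theory Num.Theory.

Set Implicit Arguments.
Unset Strict Implicit.
Unset Printing Implicit Defensive.

Local Open Scope ring_scope.

(** * Programs over [F_2] as systems of equations *)

Lemma F2P (x : 'F_2) : x = 0 \/ x = 1.
Proof.
by case: x => [[|[|k]] H]; [left; apply: val_inj | right; apply: val_inj |].
Qed.

(* The triple [(a, b, c)] stands for the equation [a = b + c]. *)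
Definition holds (N : Type) (w : N -> 'F_2) (e : N * N * N) : bool :=
  w e.1.1 == w e.1.2 + w e.2.

(* The operand positions depend on the size of the memory: the first position
   past its end serves as the constant 0. *)
Lemma op_value_F2 (o : lin_op 'F_2) : exists f : nat -> nat * nat,
  forall mem : seq 'F_2,
    op_value mem o = mem`_(f (size mem)).1 + mem`_(f (size mem)).2.
Proof.
case: o => [i j|i j|c i] /=.
- by exists (fun=> (i, j)).
- exists (fun=> (i, j)) => mem /=; congr (_ + _).
  by case: (F2P mem`_j) => ->; apply: val_inj.
- exists (fun l => (if c == 0 then l else i, l)) => mem /=.
  rewrite [mem`_(size mem)]nth_default // addr0.
  case: (F2P c) => ->; rewrite ?mul0r ?mul1r /=; last by [].
  by rewrite nth_default.
Qed.

(** Each operation gives one equation, whose left side names the cell it writes; operands past the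
    end of the memory are named [z]. As [nm] need not be injective, an input and an output may share
    a name. *)
Lemma lin_run_equations (N : Type) (nm : nat -> N) (z : N) (r : nat)
    (p : seq (lin_op 'F_2)) :
  exists2 E : seq (N * N * N), size E = size p &
    forall w : N -> 'F_2, w z = 0 ->
      (all (holds w) E <-> forall k, (k < r + size p)%N ->
        w (nm k) = (lin_run p (\col_(j < r) w (nm j)))`_k).
Proof.
elim/last_ind: p => [|p o [E sE HE]].
  exists [::] => // w _; split=> // _ k; rewrite addn0 => kr.
  rewrite /lin_run /= (nth_map (Ordinal kr)) ?size_enum_ord //.
  by rewrite mxE nth_enum_ord.
have [f Hf] := op_value_F2 o.
pose L := (r + size p)%N.
pose nm' k := if (k < L)%N then nm k else z.
exists (rcons E (nm L, nm' (f L).1, nm' (f L).2)); first by rewrite !size_rcons sE.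
move=> w wz; set v := \col_j _.
have nmE : (forall k, (k < L)%N -> w (nm k) = (lin_run p v)`_k) ->
    forall k, w (nm' k) = (lin_run p v)`_k.
  move=> Hk k; rewrite /nm'; case: ltnP => [/Hk//|Lk].
  by rewrite wz nth_default // size_lin_run.
rewrite all_rcons /holds /=; split.
  case/andP=> /eqP wL /(HE w wz) Hk k.
  rewrite size_rcons addnS ltnS leq_eqVlt => /predU1P[->|kL].
    by rewrite nth_lin_run_rcons Hf size_lin_run wL !nmE.
  by rewrite Hk // -cats1 nth_lin_run_cat.
move=> H.
have Hk k : (k < L)%N -> w (nm k) = (lin_run p v)`_k.
  by move=> kL; rewrite H ?size_rcons ?addnS ?ltnS 1?ltnW // -cats1 nth_lin_run_cat.
apply/andP; split; last exact/(HE w wz).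
by rewrite H ?size_rcons ?addnS // nth_lin_run_rcons Hf size_lin_run !nmE.
Qed.

Definition solution_set (t : nat) (U : finType)
    (E : seq (('I_t + U) * ('I_t + U) * ('I_t + U))) : {set 'cV['F_2]_t} :=
  [set \col_i w (inl i) | w : {ffun 'I_t + U -> 'F_2} & all (holds w) E]%SET.

Lemma lin_run_nth_default (F : fieldType) (b : nat) (p : seq (lin_op F))
    (v : 'cV[F]_b) k : (lin_run p v)`_(minn k (b + size p)) = (lin_run p v)`_k.
Proof.
case: (leqP k (b + size p)) => [//|/ltnW H].
by rewrite !nth_default // size_lin_run.
Qed.

(** Outputs read at one position agree on every basis vector, so their rows agree. Clamping merges
    all positions past the end, which all read 0. *)
Lemma row_inj_lin_computes (F : fieldType) (a b : nat) p (out : 'I_a -> nat)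
    (X : 'M[F]_(a, b)) : lin_computes p out X -> injective (fun i => row i X) ->
  injective (fun i => minn (out i) (b + size p)).
Proof.
move=> pX Xinj i j eqij; apply: Xinj; apply/rowP => k; rewrite !mxE.
have colE l : X l k = (X *m delta_mx k (0 : 'I_1)) l 0 by rewrite -colE mxE.
by rewrite !colE -!pX -lin_run_nth_default eqij lin_run_nth_default.
Qed.

(** The bounds [L] and [M] let all programs up to a given size share one finite type of systems. *)
Lemma range_solution_set (t r L M : nat) (p : seq (lin_op 'F_2)) out
    (X : 'M['F_2]_(t, r)) :
  lin_computes p out X -> injective (fun i => row i X) -> (r + size p <= L)%N ->
  (2 * (size p).+1 <= M)%N ->
  exists E : M.-tuple (('I_t + 'I_L.+1) * ('I_t + 'I_L.+1) * ('I_t + 'I_L.+1)),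
    solution_set E = [set X *m v | v : 'cV['F_2]_r]%SET.
Proof.
move=> pX /(row_inj_lin_computes pX) oinj rL sM.
set s := size p in oinj rL sM *.
(* Memory positions lie below [r + s <= L], so the index [L] is free for the constant 0. *)
pose z : 'I_t + 'I_L.+1 := inr ord_max.
(* [inl i] names the [i]-th output; an input that is an output gets that name. *)
pose nm k : 'I_t + 'I_L.+1 :=
  if [pick i | (k < r)%N && (out i == k)] is Some i then inl i else inr (inord k).
pose nm' k := if (k < r + s)%N then nm k else z.
have [E0 sE0 HE0] := lin_run_equations nm z r p.
pose B := [set i | (r <= out i)%N]%SET.
have nmB i : i \notin B -> nm (out i) = inl i.
  rewrite inE -ltnNge => oir; rewrite /nm; case: pickP => [j /andP[_ /eqP oj]|/(_ i)].
    by congr inl; apply: oinj; rewrite /= oj.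
  by rewrite oir eqxx.
(* Clamped outputs in [B] occupy distinct positions from [r] to [r + s], the last one being the zero
   past the end. *)
have cardB : (#|B| <= s.+1)%N.
  pose g i : 'I_s.+1 := inord (minn (out i) (r + s) - r).
  rewrite -[X in (_ <= X)%N]card_ord; apply: (@leq_card_in _ _ g) => i j.
  rewrite !inE => ri rj /(congr1 val); rewrite /= !inordK => [H||]; try lia.
  by apply: oinj => /=; lia.
(* [(z, z, z)] forces [z] to be 0; repeating it pads the system to size [M]. *)
pose K := (M - s - #|B|)%N.
pose E := E0 ++ nseq K (z, z, z) ++ [seq (inl i, nm' (out i), z) | i <- enum B].
have sE : size E == M.
  by rewrite !size_cat size_nseq size_map -cardE sE0 /K -/s; apply/eqP; lia.
(* Since [s + #|B| <= 2 * s + 1 < M], at least one copy of [(z, z, z)] is present. *)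
have K0 : (K == 0)%N = false by rewrite /K; lia.
exists (Tuple sE).
have nm'E (w : 'I_t + 'I_L.+1 -> 'F_2) (v : 'cV['F_2]_r) : w z = 0 ->
    (forall k, (k < r + s)%N -> w (nm k) = (lin_run p v)`_k) ->
    forall k, w (nm' k) = (lin_run p v)`_k.
  move=> wz Hk k; rewrite /nm'; case: ltnP => [/Hk//|Lk].
  by rewrite wz nth_default // size_lin_run.
rewrite /solution_set; apply/setP => x; apply/imsetP/imsetP => [[w]|[v _ ->]].
  rewrite inE !all_cat all_nseq K0 => /and3P[wE0 /eqP /= wz /allP wB] ->.
  have {}wz : w z = 0 by apply: (addrI (w z)); rewrite addr0.
  have Hk := (HE0 w wz).1 wE0.
  exists (\col_(j < r) w (nm j)) => //.
  apply/colP => i; rewrite -pX mxE -(nm'E w _ wz Hk).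
  have [iB|iB] := boolP (i \in B).
    have iE : i \in enum B by rewrite mem_enum.
    have := wB _ (map_f (fun i => (inl i, nm' (out i), z)) iE).
    by rewrite /holds /= wz addr0 => /eqP.
  by rewrite /nm' -(nmB i iB) ltn_addr // ltnNge; move: iB; rewrite inE.
(* Conversely, the values in a run on [v] solve the system; [z] reads past the end of the memory. *)
pose w : {ffun 'I_t + 'I_L.+1 -> 'F_2} := [ffun u : 'I_t + 'I_L.+1 => match u with
  | inl i => (X *m v) i 0 | inr k => (lin_run p v)`_k end].
have wz : w z = 0 by rewrite ffunE /z /= nth_default // size_lin_run.
have wnm k : (k < r + s)%N -> w (nm k) = (lin_run p v)`_k.
  move=> krs; rewrite /nm ffunE; case: pickP => [i /andP[_ /eqP <-]|_].
    by rewrite -pX.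
  by rewrite inordK //; lia.
have vE : \col_(j < r) w (nm j) = v.
  apply/colP => j; rewrite mxE wnm; last exact: ltn_addr.
  rewrite -[p]cat0s nth_lin_run_cat ?addn0 //.
  by rewrite /lin_run /= (nth_map j) ?size_enum_ord // nth_ord_enum.
exists w; last by apply/colP => i; rewrite [RHS]mxE ffunE.
rewrite inE !all_cat all_nseq K0; apply/and3P; split.
- by apply/(HE0 w wz) => k; rewrite vE; apply: wnm.
- by rewrite /holds /= wz addr0.
apply/allP => _ /mapP[i _ ->]; rewrite /holds /= wz addr0.
by rewrite (nm'E w v) // ffunE pX.
Qed.

(** * Counting low-cost products and matrices with repeated rows *)

Lemma leq_card_bigcup (I T : finType) (P : pred I) (A : I -> {set T}) :
  (#|\bigcup_(i | P i) A i|%SET <= \sum_(i | P i) #|A i|)%N.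
Proof.
elim/big_rec2: _ => [|i m B _ Bm]; first by rewrite cards0.
by rewrite (leq_trans (leq_card_setU _ _)) // leq_add2l.
Qed.

Lemma card_solution_set_cover (t r d s L : nat) :
  (r + s <= L)%N ->
  (#|[set X : 'M['F_2]_(t, d) | `[< injective (fun i => row i X) /\
        exists (X1 : 'M['F_2]_(t, r)) X2, X = X1 *m X2 /\ (lin_cost X1 <= s)%N >]]%SET|
    <= (t + L.+1) ^ (6 * s.+1) * 2 ^ (r * d))%N.
Proof.
move=> rsL; set N := (('I_t + 'I_L.+1) * ('I_t + 'I_L.+1) * ('I_t + 'I_L.+1))%type.
pose V (E : (2 * s.+1).-tuple N) := solution_set E.
pose C E := [set X : 'M['F_2]_(t, d) | [forall j, col j X \in V E]]%SET.
(* An arbitrary system may have a larger projection; those coming from some [X1] are images of a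
   space of dimension [r]. *)
pose small := [set E | (#|V E| <= 2 ^ r)%N]%SET.
have cardC E : E \in small -> (#|C E| <= 2 ^ (r * d))%N.
  rewrite inE => VE; pose f (X : 'M['F_2]_(t, d)) := [ffun j => col j X].
  have finj : injective f.
    move=> X Y /ffunP XY; apply/matrixP => i j; have := XY j.
    by rewrite !ffunE => /colP/(_ i); rewrite !mxE.
  rewrite -(card_imset _ finj) (@leq_trans #|@ffun_on_mem 'I_d _ (mem (V E))|) //.
    apply/subset_leq_card/fintype.subsetP => _ /imsetP[X XC ->].
    by apply/ffun_onP => j; rewrite ffunE; move: XC; rewrite inE => /forallP.
  rewrite card_ffun_on card_ord expnM.
  by case: (posnP d) => [->|d0]; rewrite ?expn0 ?leq_exp2r.
have cover : ([set X : 'M['F_2]_(t, d) | `[< injective (fun i => row i X) /\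
    exists (X1 : 'M['F_2]_(t, r)) X2, X = X1 *m X2 /\ (lin_cost X1 <= s)%N >]]
    \subset \bigcup_(E in small) C E)%SET.
  apply/fintype.subsetP => X; rewrite inE => /asboolP[Xinj [X1 [X2 [XE X1s]]]].
  have X1inj : injective (fun i => row i X1).
    by move=> i j eqij; apply: Xinj; rewrite /= XE !row_mul eqij.
  have [p [out [sp pX1]]] : lin_computable_in X1 (lin_cost X1).
    by rewrite /lin_cost; case: ex_minnP => c /asboolP.
  have [||E VE] := range_solution_set (L := L) (M := 2 * s.+1) pX1 X1inj;
    [by rewrite sp; lia..|].
  apply/bigcupP; exists E; rewrite !inE /V VE.
    rewrite (leq_trans (leq_imset_card _ _)) //.
    rewrite (leq_trans (max_card _)) //.
    by rewrite card_mx card_Fp // muln1.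
  apply/forallP => j; apply/imsetP; exists (col j X2) => //.
  by rewrite XE !colE mulmxA.
rewrite (leq_trans (subset_leq_card cover)) //.
(* There are three names in each of the [2 * s.+1] equations. *)
have -> : ((t + L.+1) ^ (6 * s.+1) = #|{: (2 * s.+1).-tuple N}|)%N.
  rewrite card_tuple !card_prod card_sum !card_ord.
  by rewrite (_ : 6 = 3 * 2)%N // -mulnA expnM !expnS expn0 muln1 mulnA.
rewrite (leq_trans (leq_card_bigcup _ _)) //.
rewrite (@leq_trans (\sum_(E in small) 2 ^ (r * d))%N) //; first exact: leq_sum.
by rewrite sum_nat_const leq_mul2r max_card orbT.
Qed.

(** Deleting row [j] loses no information: row [i] survives and is a copy of it. *)
Lemma card_eq_rows (F : finType) (t d : nat) (i j : 'I_t) : i != j ->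
  (#|[set X : 'M[F]_(t, d) | row i X == row j X]%SET| <= #|F| ^ (t.-1 * d))%N.
Proof.
move=> ij; rewrite -card_mx; apply: (@leq_card_in _ _ (row' j)) => X Y.
rewrite !inE => /eqP/rowP Xij /eqP/rowP Yij /matrixP XY.
have XYlift k l : X (lift j k) l = Y (lift j k) l by have := XY k l; rewrite !mxE.
apply/matrixP => k l; case: (unliftP j k) => [k' ->//|->].
have := Xij l; have := Yij l; rewrite !mxE => <- <-.
by case: (unliftP j i) ij => [i' -> _|->]; rewrite ?eqxx.
Qed.

Lemma card_not_row_inj (F : finType) (t d : nat) :
  (#|[set X : 'M[F]_(t, d) | ~~ `[< injective (fun i => row i X) >]]%SET|
    <= t ^ 2 * #|F| ^ (t.-1 * d))%N.
Proof.
pose D (ij : 'I_t * 'I_t) := [set X : 'M[F]_(t, d) | row ij.1 X == row ij.2 X]%SET.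
have sub : ([set X : 'M[F]_(t, d) | ~~ `[< injective (fun i => row i X) >]]
    \subset \bigcup_(ij | ij.1 != ij.2) D ij)%SET.
  apply/fintype.subsetP => X; rewrite inE => /asboolPn Xinj; apply/bigcupP.
  apply: contrapT => noD; apply: Xinj => i j /= eqij; apply/eqP.
  by apply: contrapT => /negP ij; apply: noD; exists (i, j); rewrite // inE; apply/eqP.
rewrite (leq_trans (subset_leq_card sub)) // (leq_trans (leq_card_bigcup _ _)) //.
rewrite (@leq_trans (\sum_(ij : 'I_t * 'I_t | ij.1 != ij.2) #|F| ^ (t.-1 * d))%N) //.
  by apply: leq_sum => -[i j] ij; apply: card_eq_rows.
rewrite sum_nat_const leq_mul2r (leq_trans (max_card _)) ?orbT //.
by rewrite card_prod !card_ord.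
Qed.

(** * Choice of constants and the final estimate *)

Lemma trunc_log_le_ln (R : realType) (n : nat) : (1 < n)%N ->
  (trunc_log 2 n).+1%:R <= 4 * ln (n%:R : R).
Proof.
move=> n1; set k := trunc_log 2 n.
have n0 : (0 < n)%N by exact: ltnW.
have k1 : (1 <= k)%N by rewrite trunc_log_max.
(* This is [ln (1 + x) <= x] at [x = - 1 / 2]. *)
have ln2 : (1 / 2 : R) <= ln 2.
  have := @le_ln1Dx R (- (1 / 2)) ltac:(lra).
  by rewrite (_ : 1 + - (1 / 2) = 2^-1 :> R) ?lnV ?posrE; lra.
have : ln (2 ^+ k : R) <= ln n%:R.
  by rewrite ler_ln ?posrE ?exprn_gt0 ?ltr0n // -natrX ler_nat trunc_logP.
rewrite lnXn // -[ln 2 *+ k]mulr_natr -[k.+1%:R]natr1 => H.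
have k1' : (1 : R) <= k%:R by rewrite ler1n.
have : (1 / 2 : R) * k%:R <= ln 2 * k%:R by rewrite ler_wpM2r.
lra.
Qed.

(** Here [576 = 4 * 144], the 4 being the loss in passing from [ln] to the binary logarithm. *)
Lemma low_cost_bound (R : realType) (n k s : nat) : (1 < n)%N -> (0 < k)%N ->
  s%:R / k%:R < 576^-1 * ((n ^ 2)%:R / ln (n%:R : R)) ->
  (s <= (k * n ^ 2) %/ (144 * (trunc_log 2 n).+1))%N.
Proof.
move=> n1 k0 H; rewrite leq_divRL //.
have m4 := trunc_log_le_ln R n1; set m := (trunc_log 2 n).+1 in m4 *.
have m1 : (1 : R) <= m%:R by rewrite ler1n.
have l0 : 0 < ln (n%:R : R) by lra.
move: H; rewrite ltr_pdivrMr ?ltr0n // mulrA mulrAC ltr_pdivlMr // => H.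
rewrite -(ler_nat R) !natrM.
have : s%:R * m%:R <= s%:R * (4 * ln n%:R) :> R by rewrite ler_wpM2l.
move: H; rewrite mulrAC -mulrA -natrM [X in X < _]mulrC.
by rewrite -[144%:R]/(144 : R) natrM; lra.
Qed.

(** The term [t ^ 2] pays for pairs of equal rows, the term [t] for the choice of [r]. *)
Lemma card_bad (R : realType) (n t : nat) :
  (144 <= n)%N -> (0 < t)%N -> (t <= n ^ 3)%N ->
  (#|[pred X : 'M['F_2]_(t, n ^ 2) | `[< bad (576^-1 : R) X >]]|
    <= (t ^ 2 + t) * 2 ^ (t * n ^ 2 - (n ^ 2)./2))%N.
Proof.
move=> n144 t0 tn3; set m := (trunc_log 2 n).+1.
have nm : (n <= 2 ^ m)%N by apply/ltnW/trunc_log_ltn.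
have mn : (m <= n)%N.
  by rewrite /m (leq_trans (ltn_expl _ (isT : 1 < 2)%N)) // trunc_logP //; lia.
pose S r := ((t - r) * n ^ 2 %/ (144 * m))%N.
pose A r := [set X : 'M['F_2]_(t, n ^ 2) | `[< injective (fun i => row i X) /\
  exists (X1 : 'M['F_2]_(t, r)) X2, X = X1 *m X2 /\ (lin_cost X1 <= S r)%N >]]%SET.
pose D := [set X : 'M['F_2]_(t, n ^ 2) | ~~ `[< injective (fun i => row i X) >]]%SET.
have sub : [pred X : 'M['F_2]_(t, n ^ 2) | `[< bad (576^-1 : R) X >]]
    \subset (D :|: \bigcup_(r < t) A r)%SET.
  apply/fintype.subsetP => X /asboolP[r [X1 [X2 [_ rt XE cX1]]]]; rewrite inE.
  case: (boolP (X \in D)) => //=; rewrite inE negbK => /asboolP Xinj.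
  apply/bigcupP; exists (Ordinal rt) => //; rewrite inE; apply/asboolP; split=> //.
  exists X1, X2; split=> //; apply: low_cost_bound cX1; last by rewrite subn_gt0.
  by lia.
rewrite (leq_trans (subset_leq_card sub)) // (leq_trans (leq_card_setU _ _)) //.
rewrite mulnDl leq_add //.
  rewrite (leq_trans (card_not_row_inj _ _ _)) // card_Fp // leq_mul2l.
  by rewrite leq_pexp2l ?orbT //; nia.
rewrite (leq_trans (leq_card_bigcup _ _)) //.
rewrite -[X in (_ <= X * _)%N]card_ord -sum_nat_const; apply: leq_sum => r _.
have rt := ltn_ord r.
have Sn : (S r <= n ^ 5)%N.
  rewrite (leq_trans (leq_div _ _)) // (expnD n 3 2) leq_mul2r.
  by apply/orP; right; lia.
have rS : (r + S r <= r + S r)%N by [].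
rewrite (leq_trans (card_solution_set_cover t (n ^ 2) rS)) //.
have base : (t + (r + S r).+1 <= 2 ^ (6 * m))%N.
  rewrite mulnC expnM (@leq_trans (n ^ 6)) ?leq_exp2r //.
  have e6 : (n ^ 6 = n * n ^ 5)%N by rewrite expnS.
  have e5 : (n ^ 5 = n ^ 2 * n ^ 3)%N by rewrite -expnD.
  have e3 : (1 <= n ^ 3)%N by rewrite expn_gt0; lia.
  have e2 : (1 <= n ^ 2)%N by rewrite expn_gt0; lia.
  nia.
rewrite (@leq_trans (2 ^ (6 * m * (6 * (S r).+1)) * 2 ^ (r * n ^ 2))%N) //.
  by rewrite leq_mul2r [(2 ^ (6 * m * _))%N]expnM orbC leq_exp2r ?base.
rewrite -expnD leq_pexp2l //.
(* The systems cost [36 * m * (S r + 1)] bits. As [144 = 4 * 36], both [36 * m * S r] and [36 * m]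
   are at most a quarter of [(t - r) * n ^ 2], so at least half of the saving remains. *)
have S144 : (S r * (144 * m) <= (t - r) * n ^ 2)%N by exact: leq_divM.
have m144 : (144 * m <= n ^ 2)%N by rewrite expnS expn1 leq_mul.
have half : (2 * (n ^ 2)./2 <= n ^ 2)%N by lia.
have tr : (t * n ^ 2 = r * n ^ 2 + (t - r) * n ^ 2)%N by nia.
have tr1 : (n ^ 2 <= (t - r) * n ^ 2)%N by rewrite leq_pmull // subn_gt0.
nia.
Qed.

Theorem theoremB2 (R : realType) :
  exists2 c0 : R, 0 < c0 &
    forall eps : R, 0 < eps ->
      exists N : nat, forall n t : nat,
        (N <= n)%N -> (0 < n)%N -> (0 < t)%N -> (n ^ 2 <= t)%N ->
        (t%:R : R) < n%:R `^ (281%:R / 100%:R) ->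
        bad_fraction c0 n t < eps.
Proof.
exists 576^-1; first by lra.
(* The bad fraction will be at most [1 / n], hence the bound by [eps^-1]. *)
move=> eps eps0; exists (maxn 144 (Num.truncn eps^-1).+1) => n t.
rewrite geq_max => /andP[n144 neps] n0 t0 n2t tn.
have {tn}tn3 : (t <= n ^ 3)%N.
  rewrite -(ler_nat R) natrX -powR_mulrn // (le_trans (ltW tn)) //.
  by rewrite ler_powR ?ler1n //; lra.
set m := (trunc_log 2 n).+1.
have nm : (n < 2 ^ m)%N by apply: trunc_log_ltn.
have mn : (m <= n)%N.
  by rewrite /m (leq_trans (ltn_expl _ (isT : 1 < 2)%N)) // trunc_logP.
(* The chain is [(t ^ 2 + t) * n <= n ^ 8 <= 2 ^ (8 * m)], with [16 * m <= n ^ 2] because [m <= n]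
   and [144 <= n]. *)
have poly : ((t ^ 2 + t) * n <= 2 ^ (n ^ 2)./2)%N.
  apply: (@leq_trans (n ^ 8)).
    have : (t ^ 2 <= n ^ 6)%N by rewrite (expnM n 3 2) leq_exp2r.
    have : (n ^ 3 <= n ^ 6)%N by rewrite leq_pexp2l.
    have -> : (n ^ 8 = n * n ^ 6 * n)%N by rewrite -expnS -expnSr.
    by rewrite leq_mul2r => H1 H2; apply/orP; right; nia.
  apply: (@leq_trans ((2 ^ m) ^ 8)); first by rewrite leq_exp2r // ltnW.
  rewrite -expnM leq_pexp2l // geq_half_double -muln2.
  by rewrite [(n ^ 2)%N]expnS expn1; nia.
have half : ((n ^ 2)./2 <= t * n ^ 2)%N.
  by rewrite (leq_trans (half_leq (leqnn _))) //; nia.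
have total : (#|[pred X : 'M['F_2]_(t, n ^ 2) | `[< bad (576^-1 : R) X >]]| * n
    <= 2 ^ (t * n ^ 2))%N.
  rewrite (leq_trans (leq_mul (card_bad R n144 t0 tn3) (leqnn n))) //.
  by rewrite mulnAC -[X in (_ <= 2 ^ X)%N](subnKC half) expnD leq_mul2r poly orbT.
have epsn : eps^-1 < n%:R.
  by rewrite (lt_le_trans (truncnS_gt _)) // ler_nat.
rewrite /bad_fraction ltr_pdivrMr ?ltr0n ?expn_gt0 //.
rewrite -(ltr_pM2r (_ : 0 < n%:R :> R)) ?ltr0n // -natrM.
rewrite (@le_lt_trans _ _ (2 ^ (t * n ^ 2))%:R) ?ler_nat //.
rewrite mulrAC -[X in X < _]mul1r ltr_pM2r ?ltr0n ?expn_gt0 //.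
by rewrite mulrC -ltr_pdivrMr // mul1r.
Qed.
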